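(* Let $A\in\mathbb{C}^{n\times n}$ with $\alpha(A)<0$, let $\gamma\in[0,1)$ and $\eta\ge 0$, and let $(x_\star,y_\star)$ be a global minimizer of $g$ over $\{(x,y): x>0,\ y\in\mathbb{R}\}$. If $\mathcal{K}(A)^{-1}\le\gamma$ and $\eta\in\left[0,\,\tfrac{2x_\star}{1+\gamma}(\gamma-\mathcal{K}(A)^{-1})\right]$, then there exists a pair $x,y\in\mathbb{R}$ with $x>0$ such that $$g(x,y)=g(x+\eta,y)=\gamma.$$
   Context: $\alpha(A)$ is the spectral abscissa (largest real part of an eigenvalue), $\sigma_{\min}$ the smallest singular value, $\|\cdot\|$ the spectral norm, $\mathbf{i}$ the imaginary unit. The continuous-time Kreiss constant is $\mathcal{K}(A)=\sup_{z\in\mathbb{C},\,\mathrm{Re}\,z>0}(\mathrm{Re}\,z)\|(zI-A)^{-1}\|$. For $x\neq 0$ and $y\in\mathbb{R}$ define $$g(x,y)=\sigma_{\min}\!\left(\frac{(x+\mathbf{i}y)I-A}{x}\right),$$ so that $\mathcal{K}(A)^{-1}=\inf_{x>0,\,y\in\mathbb{R}}g(x,y)$. A global minimizer $(x_\star,y_\star)$ satisfies $x_\star>0$ and $g(x_\star,y_\star)=\mathcal{K}(A)^{-1}$. *)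

(* Defs.v *)
From mathcomp Require Import all_boot all_order all_algebra.
From mathcomp Require Import spectral sesquilinear complex.
From mathcomp Require Import all_classical all_reals ereal.

Set Implicit Arguments.
Unset Strict Implicit.
Unset Printing Implicit Defensive.

Import Order.TTheory GRing.Theory Num.Theory.

Local Open Scope classical_set_scope.
Local Open Scope sesquilinear_scope.
Local Open Scope complex_scope.
Local Open Scope ring_scope.

(* The qualified [complex.Re] and [ComplexField.Normc.normc] are the real part
   and the modulus with values in [R], whereas [Num.Theory]'s ['Re z] and
   [`|z|] take values in [R[i]]. *)

Section Kreiss.
Variables (R : realType) (n : nat).
Implicit Types (A M : 'M[R[i]]_n) (v : 'cV[R[i]]_n).

(* For [n > 0] the set of eigenvalues is finite and nonempty, so that this
   supremum is a maximum. *)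
Definition spectral_abscissa A : R :=
  sup [set complex.Re a | a in [set a : R[i] | eigenvalue A a]].

Definition singular_value M (s : R) : Prop :=
  0 <= s /\ eigenvalue (M ^t* *m M) (s ^+ 2)%:C.

(* Again a minimum when [n > 0]. *)
Definition sigma_min M : R := inf [set s | singular_value M s].

Definition norm2 v : R :=
  Num.sqrt (\sum_i ComplexField.Normc.normc (v i 0) ^+ 2).

Definition spectral_norm M : R :=
  sup [set norm2 (M *m v) | v in [set v | norm2 v = 1]].

(* [invmx M] is [M] when [M] is singular; the norm of the resolvent is taken to
   be infinite on the spectrum. *)
Definition resolvent_norm A (z : R[i]) : \bar R :=
  if z%:M - A \in unitmx then (spectral_norm (invmx (z%:M - A)))%:E else +oo%E.

Definition kreiss_constant A : \bar R :=
  ereal_sup [set ((complex.Re z)%:E * resolvent_norm A z)%E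
            | z in [set z : R[i] | 0 < complex.Re z]].

Definition kreiss_g A (x y : R) : R :=
  sigma_min ((x%:C)^-1 *: ((x +i* y)%:M - A)).

Definition kreiss_global_minimizer A (xs ys : R) : Prop :=
  0 < xs /\ forall x y : R, 0 < x -> kreiss_g A xs ys <= kreiss_g A x y.

End Kreiss.

(* Main.v *)
Require Import Defs.
From mathcomp Require Import all_boot all_order all_algebra.
From mathcomp Require Import spectral sesquilinear complex.
From mathcomp Require Import all_classical all_reals ereal.
From mathcomp Require Import topology normedtype derive.
From mathcomp Require Import zify ring lra.

(* Let [f x y] be the smallest singular value of [(x + iy)I - A]; it is
   1-Lipschitz, and [g = gamma] means that [phi := f - gamma x] vanishes.  Since
   [A] is stable and [gamma < 1], [phi > 0] for [x <= 0] and near infinity, while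
   the Lipschitz bound around the minimizer produces a horizontal segment of
   length [eta] on which [phi <= 0].  It remains to find a horizontal chord of
   length exactly [eta] with both ends on the zero set of [phi].

   This is a planar fact, proved on a fine square grid of mesh [eta / m].  Let
   [F] be the grid component of [phi <= 0] that contains the segment, and [G] the
   same set shifted by [-eta].  If no grid square meets the boundaries of both,
   the pair of indicator functions [(F, G)] runs through the 4-cycle of its
   values, and the parity of the crossings of one edge of that 4-cycle has a
   potential, the plane being simply connected.  But in the closed walk from a
   common point, through [F] to its rightmost point, then outside [G] to infinity,
   back outside [F] to the leftmost point of [G], and through [G] to the start,
   that edge is crossed an odd number of times.  Letting [m] tend to infinity and
   using compactness gives an exact chord. *)

Set Implicit Arguments.
Unset Strict Implicit.
Unset Printing Implicit Defensive.

Import Order.TTheory GRing.Theory Num.Theory.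
Import numFieldNormedType.Exports.

(** * A chord of prescribed length in the integer grid *)

Definition grid_adj (p q : nat * nat) : bool :=
  (p.1 == q.1) && ((q.2 == p.2.+1) || (p.2 == q.2.+1))
  || (p.2 == q.2) && ((q.1 == p.1.+1) || (p.1 == q.1.+1)).

Inductive grid_component (N : nat * nat -> Prop) (p0 : nat * nat) :
    nat * nat -> Prop :=
| grid_component0 : N p0 -> grid_component N p0 p0
| grid_componentS p q :
    grid_component N p0 p -> grid_adj p q -> N q -> grid_component N p0 q.

Lemma grid_component_sub N p0 p : grid_component N p0 p -> N p.
Proof. by case. Qed.

Definition constant_on_square (F : nat -> nat -> bool) (i j : nat) : bool :=
  [&& F i j == F i.+1 j, F i j == F i j.+1 & F i j == F i.+1 j.+1].

(** Going round the square, a non-constant indicator must drop from true to false along some edge.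
    Such a node [p] is where [phi] will turn out small. *)
Lemma constant_on_squarePn F i j : ~~ constant_on_square F i j ->
  exists2 p : nat * nat, [/\ i <= p.1 <= i.+1, j <= p.2 <= j.+1 & F p.1 p.2] &
    exists2 q, grid_adj p q & ~~ F q.1 q.2.
Proof.
have H p q : i <= p.1 <= i.+1 -> j <= p.2 <= j.+1 -> grid_adj p q ->
    F p.1 p.2 -> ~~ F q.1 q.2 ->
  exists2 p : nat * nat, [/\ i <= p.1 <= i.+1, j <= p.2 <= j.+1 & F p.1 p.2] &
    exists2 q, grid_adj p q & ~~ F q.1 q.2 by move=> *; exists p => //; exists q.
rewrite /constant_on_square.
case F00: (F i j); case F10: (F i.+1 j); case F01: (F i j.+1);
  case F11: (F i.+1 j.+1) => //= _.
all: try by apply: (H (i, j) (i.+1, j)); rewrite /grid_adj /= ?F00 ?F10 //; lia.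
all: try by apply: (H (i, j) (i, j.+1)); rewrite /grid_adj /= ?F00 ?F01 //; lia.
all: try by apply: (H (i.+1, j) (i, j)); rewrite /grid_adj /= ?F00 ?F10 //; lia.
all: try by apply: (H (i, j.+1) (i, j)); rewrite /grid_adj /= ?F00 ?F01 //; lia.
all: try by apply: (H (i.+1, j.+1) (i.+1, j));
  rewrite /grid_adj /= ?F11 ?F10 //; lia.
all: try by apply: (H (i.+1, j) (i.+1, j.+1));
  rewrite /grid_adj /= ?F11 ?F10 //; lia.
Qed.

Section GridChord.
Variables (F : nat -> nat -> bool) (m L i0 j0 : nat).
Hypothesis m_gt0 : 0 < m.
Hypothesis F_box : forall i j, F i j -> [/\ m < i, 0 < j & i <= L].
Hypothesis F0 : F i0 j0.
Hypothesis Fm : F (i0 + m) j0.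
(** Connectedness as an induction principle: a quantity is constant on [F] once single steps inside
    [F] preserve it. *)
Hypothesis F_connected : forall P : nat * nat -> Prop, P (i0, j0) ->
  (forall p q, F p.1 p.2 -> F q.1 q.2 -> grid_adj p q -> P p -> P q) ->
  forall p, F p.1 p.2 -> P p.

Let G i j := F (i + m) j.

(* The potential: along row [j], the parity of the number of steps left of
   column [i] that cross the boundary of [F] inside [G]. *)
Fixpoint crossing_parity (j i : nat) : bool :=
  if i is k.+1 then
    crossing_parity j k (+) [&& G k j, G k.+1 j & F k j (+) F k.+1 j]
  else false.

Hypothesis no_chord : forall i j,
  constant_on_square F i j || constant_on_square G i j.

Lemma F_out i j : (i <= m) || (j == 0) || (L < i) -> F i j = false.
Proof. by move=> H; apply/negP => /F_box []; lia. Qed.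

(** Path independence: the crossings around a square are even in number. If [F] is constant there
    are none; if [G] is constant, either none counts or all do, and [F] changes an even number of
    times. The induction starts in column 0, where [G] is empty. *)
Lemma crossing_parity_vertical i j :
  crossing_parity j.+1 i =
  crossing_parity j i (+) [&& G i j, G i j.+1 & F i j (+) F i j.+1].
Proof.
elim: i => [|i IH] /=; first by rewrite /G F_out ?add0n ?leqnn.
rewrite IH; have := no_chord i j; rewrite /constant_on_square.
move: (crossing_parity j i) (F i j) (F i.+1 j) (F i j.+1) (F i.+1 j.+1)
  (G i j) (G i.+1 j) (G i j.+1) (G i.+1 j.+1).
by do 9 case.
Qed.

(** The way to infinity outside [G]: vertical steps there do not change the parity, and row 0 lies
    outside [F]. *)
Lemma crossing_parity_right i j : (forall j', G i j' = false) ->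
  crossing_parity j i = false.
Proof.
move=> Gi; elim: j => [|j IH]; last by rewrite crossing_parity_vertical IH Gi.
elim: i {Gi} => //= i ->.
by rewrite (@F_out i) ?(@F_out i.+1) ?eqxx ?orbT // !andbF.
Qed.

Lemma crossing_parity_left i j : (forall i', i' <= i -> F i' j = false) ->
  crossing_parity j i = false.
Proof.
elim: i => //= i IH Fi; rewrite IH; last by move=> k ki; apply: Fi; lia.
by rewrite !Fi // !andbF.
Qed.

Lemma no_chord_absurd : False.
Proof.
pose P i := `[< exists j, F i j >].
have exP : exists i, P i by exists i0; apply/asboolP; exists j0.
have ubP i : P i -> i <= L by move=> /asboolP [j /F_box []].
have [r /asboolP [jr Fr] r_max] := ex_maxnP exP ubP.
have [l /asboolP [jl Fl] l_min] := ex_minnP exP.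
have F_gt i j : r < i -> F i j = false.
  move=> ri; apply/negP => Fij; move: ri; rewrite ltnNge => /negP; apply.
  by apply: r_max; apply/asboolP; exists j.
have F_lt i j : i < l -> F i j = false.
  move=> il; apply/negP => Fij; move: il; rewrite ltnNge => /negP; apply.
  by apply: l_min; apply/asboolP; exists j.
(* Steps inside [F] never cross its boundary. *)
have parityF p : F p.1 p.2 -> crossing_parity p.2 p.1 = crossing_parity j0 i0.
  apply: (F_connected (P := fun p => _ = _)) => // -[i j] [i' j'] /= Fp Fq.
  case/orP => /andP[/eqP/= ? /orP[]] /eqP ? <-; subst;
    rewrite ?crossing_parity_vertical /= Fp Fq !andbF addbF //.
(* [G] is [F] moved left by [m > 0], so it misses the last column [r] of [F]. *)
have h0 : crossing_parity j0 i0 = false.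
  rewrite -(parityF (r, jr)) //= crossing_parity_right // => j.
  by rewrite /G F_gt //; lia.
(* Inside [G] the parity flips exactly when [F] does, so their sum is constant. Points of [G] are
   written as points [p] of [F] moved left by [m]. *)
have parityG p : F p.1 p.2 -> crossing_parity p.2 (p.1 - m) (+) F (p.1 - m) p.2
   = crossing_parity j0 i0 (+) F i0 j0.
  move=> Fp.
  (* The induction over [F] starts from column [i0 - m] of [G]; evaluating it at [(i0 + m, j0)]
     moves the constant to column [i0]. *)
  suff : forall p, F p.1 p.2 ->
     crossing_parity p.2 (p.1 - m) (+) F (p.1 - m) p.2 =
     crossing_parity j0 (i0 - m) (+) F (i0 - m) j0.
    by move=> H; rewrite H // -[LHS](H (i0 + m, j0)) //= addnK.
  apply: (F_connected (P := fun p => _ = _)) => // -[i j] [i' j'] /= {}Fp Fq.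
  have [mi _ _] := F_box Fp; have [mi' _ _] := F_box Fq.
  case/orP => /andP[/eqP/= ? /orP[]] /eqP ? <-; subst.
  - rewrite crossing_parity_vertical /G subnK ?(ltnW mi) // Fp Fq /=.
    by rewrite -addbA; congr addb; case: (F _ _); case: (F _ _).
  - rewrite crossing_parity_vertical /G subnK ?(ltnW mi) // Fp Fq /=.
    by rewrite -addbA; congr addb; case: (F _ _); case: (F _ _).
  - rewrite subSn ?(ltnW mi) //= /G addSn subnK ?(ltnW mi) // Fp Fq /=.
    by rewrite -addbA; congr addb; case: (F _ _); case: (F _ _).
  - rewrite subSn ?(ltnW mi') //= /G addSn subnK ?(ltnW mi') // Fp Fq /=.
    by rewrite -addbA; congr addb; case: (F _ _); case: (F _ _).
(* At the leftmost point of [G] both summands are false, whereas the constant is true by [h0] and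
   [F0]. *)
have := parityG (l, jl) Fl; rewrite h0 F0 /= crossing_parity_left /= ?F_lt //.
- by have [? _ _] := F_box Fl; lia.
- by move=> i' ?; apply: F_lt; have [? _ _] := F_box Fl; lia.
Qed.

End GridChord.

Local Open Scope ring_scope.

(** * Horizontal chords of plane level sets *)

Section LipschitzPlane.
Local Open Scope classical_set_scope.

Lemma ler_dist_natM (R : realType) (c d h : R) (k u v : nat) : 0 <= h ->
  (k <= u <= k.+1)%N -> (k <= v <= k.+1)%N ->
  `|c + (u%:R - d) * h - (c + (v%:R - d) * h)| <= h.
Proof.
move=> h0; have ek w : (k <= w <= k.+1)%N -> w = k \/ w = k.+1 by lia.
move=> /ek[->|->] /ek[->|->]; rewrite ?subrr ?normr0 //.
  by rewrite -natr1 ler_norml; apply/andP; split; lra.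
by rewrite -natr1 ler_norml; apply/andP; split; lra.
Qed.

Lemma lipschitz_continuous2 (R : realType) (psi : R * R -> R) (k : R) :
  (forall p q : R * R, `|psi p - psi q| <= k * (`|p.1 - q.1| + `|p.2 - q.2|)) ->
  continuous psi.
Proof.
move=> lip p; have k0 : 0 <= k.
  have := lip (1, 0) (0, 0); rewrite /= !subr0 normr1 normr0 addr0 mulr1.
  by apply: le_trans.
apply/cvgrPdist_le => e e0.
have k1 : 0 < 2 * (k + 1) by lra.
have [d d0 ->] : exists2 d : R, 0 < d & e = 2 * (k + 1) * d.
  exists (e / (2 * (k + 1))); first by rewrite divr_gt0.
  by rewrite mulrC divfK // gt_eqF.
near=> q.
apply: le_trans (lip _ _) _.
have [h1 h2] : `|p.1 - q.1| <= d /\ `|p.2 - q.2| <= d.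
  split; near: q.
    have : (fun q : R * R => q.1) @ p --> p.1 by exact: cvg_fst.
    by move/cvgrPdist_le; apply.
  have : (fun q : R * R => q.2) @ p --> p.2 by exact: cvg_snd.
  by move/cvgrPdist_le; apply.
apply: le_trans (ler_wpM2l k0 (lerD h1 h2)) _; nra.
Unshelve. all: by end_near.
Qed.

(** The chord of length zero: the intermediate value theorem between [a] and [B + 1], a point
    outside the box and hence with [phi > 0]. *)
Lemma lipschitz_zero_on_line (R : realType) (phi : R -> R -> R) (K B a b : R) :
  (forall x y x' y', `|phi x y - phi x' y'| <= K * (`|x - x'| + `|y - y'|)) ->
  (forall x y, phi x y <= 0 -> `|x| <= B /\ `|y| <= B) ->
  phi a b <= 0 -> exists x, phi x b = 0.
Proof.
move=> phi_lip phi_box phi_le0.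
have aB : a <= B + 1.
  have [aB _] := phi_box _ _ phi_le0; have := le_trans (ler_norm a) aB; lra.
have phi_gt0 : 0 < phi (B + 1) b.
  rewrite ltNge; apply/negP => /phi_box[BB _].
  by have := le_trans (ler_norm (B + 1)) BB; lra.
have phi_cont : continuous (fun p : R * R => phi p.1 p.2).
  by apply: (@lipschitz_continuous2 _ _ K) => p q; exact: phi_lip.
have cont : continuous (fun x => phi x b).
  move=> x; have pair_cont : {for x, continuous (fun z : R => (z, b))}.
    apply: (@cvg_pair _ _ _ _ (nbhs x) (nbhs b)); first exact: cvg_id.
    exact: cvg_cst.
  exact: (continuous_comp pair_cont (phi_cont _)).
have [|x _ phix] := @IVT _ _ _ _ 0 aB (continuous_subspaceT cont).
  by rewrite ge_min le_max phi_le0 (ltW phi_gt0) orbT.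
by exists x.
Qed.

Section HorizontalChord.
Variables (R : realType) (phi : R -> R -> R) (K B a b eta : R).
Hypothesis phi_lip : forall x y x' y',
  `|phi x y - phi x' y'| <= K * (`|x - x'| + `|y - y'|).
Hypothesis phi_box : forall x y, phi x y <= 0 -> `|x| <= B /\ `|y| <= B.
Hypothesis eta_gt0 : 0 < eta.
Hypothesis phi_seg : forall t : R, 0 <= t <= eta -> phi (a + t) b <= 0.

(** Some square of mesh [h = eta / m] meets the boundaries of both the component and its shift.
    Boundary nodes satisfy [|phi| <= K * h], and moving between two nodes of one square costs at
    most [2 * K * h], whence the factor 3. *)
Lemma approximate_horizontal_chord (m : nat) : (0 < m)%N ->
  exists x y, [/\ phi x y <= 0, `|phi x y| <= K * (eta / m%:R) &
    `|phi (x + eta) y| <= K * (3 * (eta / m%:R))].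
Proof.
move=> m_gt0; have eta0 := eta_gt0.
have [h hE] : {h : R | h = eta / m%:R} by exists (eta / m%:R).
rewrite -hE.
have m0 : 0 < m%:R :> R by rewrite ltr0n.
have h0 : 0 < h by rewrite hE divr_gt0.
have mh : m%:R * h = eta by rewrite hE mulrC divfK // gt_eqF.
have K0 : 0 <= K.
  have := phi_lip 1 0 0 0; rewrite !subr0 normr1 normr0 addr0 mulr1.
  by apply: le_trans.
have bound (c : R) : exists2 c' : R, 0 <= c' & c <= c' /\ - c <= c'.
  by exists `|c| => //; rewrite ler_norm -normrN ler_norm.
have [a' ? [? ?]] := bound a; have [b' ? [? ?]] := bound b.
have [B' ? [? _]] := bound B.
(* [(a, b)] will be the node [(D, D)]. The size of [D] puts columns up to [m], row 0 and columns
   beyond [D + D] outside the box containing [phi <= 0], as [F_box] demands. *)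
have [D sD] : exists D : nat, a' + b' + B' + eta < D%:R * h :> R.
  exists (Num.bound ((a' + b' + B' + eta) / h)); rewrite -ltr_pdivrMr //.
  by apply: archi_boundP; rewrite divr_ge0 ?(ltW h0) // !addr_ge0 // ltW.
have [hB ha hb] : [/\ D%:R * h > eta + B - a, D%:R * h > eta + B + a &
   D%:R * h > B - b]
  by split; lra.
pose X (i : nat) : R := a + (i%:R - D%:R) * h.
pose Y (j : nat) : R := b + (j%:R - D%:R) * h.
pose N (p : nat * nat) := phi (X p.1) (Y p.2) <= 0.
pose F i j := `[< grid_component N (D, D) (i, j) >].
have FN i j : F i j -> phi (X i) (Y j) <= 0.
  by move=> /asboolP/grid_component_sub.
have N0 k : (k <= m)%N -> N (D + k, D)%N.
  move=> km; rewrite /N /X /Y /= subrr mul0r addr0 natrD [D%:R + _]addrC addrK.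
  apply: phi_seg; rewrite mulr_ge0 ?ler0n ?(ltW h0) //=.
  by rewrite -mh ler_pM2r // ler_nat.
have Fseg k : (k <= m)%N -> F (D + k)%N D.
  elim: k => [|k IH] km; apply/asboolP.
    rewrite addn0; apply: grid_component0.
    by have := N0 0%N (leq0n _); rewrite addn0.
  apply: (@grid_componentS _ _ (D + k, D)%N); last exact: N0.
    by apply/asboolP; apply: IH; exact: ltnW.
  by rewrite /grid_adj /= addnS !eqxx orbT.
have F_box i j : F i j -> [/\ (m < i)%N, (0 < j)%N & (i <= D + D)%N].
  move=> /FN/phi_box[]; rewrite !ler_norml => /andP[Xl Xr] /andP[Yl _].
  split; [rewrite ltnNge | rewrite ltnNge | rewrite leqNgt]; apply/negP.
  - move=> im; have : i%:R * h <= eta by rewrite -mh ler_pM2r // ler_nat.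
    by move: Xl; rewrite /X; lra.
  - by rewrite leqn0 => /eqP j0; move: Yl; rewrite /Y j0; lra.
  - move=> iD; have : (D + D)%:R * h <= i%:R * h.
      by rewrite ler_pM2r // ler_nat ltnW.
    by rewrite natrD; move: Xr; rewrite /X; lra.
have F_connected (P : nat * nat -> Prop) : P (D, D) ->
    (forall p q, F p.1 p.2 -> F q.1 q.2 -> grid_adj p q -> P p -> P q) ->
    forall p, F p.1 p.2 -> P p.
  move=> P0 PS [i j] /asboolP /=; elim=> // p q pC IH pq Nq.
  apply: (PS p) => //; first by case: (p) pC => ? ? ?; apply/asboolP.
  by apply/asboolP; case: (q) pq Nq => ? ? *; apply: grid_componentS pC _ _.
have : ~ forall i j, constant_on_square F i j ||
    constant_on_square (fun i j => F (i + m)%N j) i j.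
  apply: no_chord_absurd m_gt0 F_box _ (Fseg m (leqnn m)) F_connected.
  by have := Fseg 0%N (leq0n _); rewrite addn0.
move=> /existsNP[i /existsNP[j /negP]]; rewrite negb_or => /andP[].
(* A neighbour outside the component has [phi > 0], or it would belong to it. So [phi] changes sign
   within one mesh. *)
have bdry u v q : F u v -> grid_adj (u, v) q -> ~~ F q.1 q.2 ->
    `|phi (X u) (Y v)| <= K * h.
  case: q => u' v' /= Fuv uv Fu'v'.
  have phi_gt : 0 < phi (X u') (Y v').
    rewrite ltNge; apply/negP => Nuv; move/negP: Fu'v'; apply; apply/asboolP.
    by apply: grid_componentS uv Nuv; apply/asboolP.
  have d1 : `|X u - X u'| + `|Y v - Y v'| = h.
    have e1 : `|h| = h by rewrite gtr0_norm.
    have e2 : `|- h| = h by rewrite normrN.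
    have E (w : nat) c :
        `|c + (w%:R - D%:R) * h - (c + (w.+1%:R - D%:R) * h)| = h.
      by rewrite -[RHS]e2; congr `|_|; rewrite -natr1; ring.
    have := uv; rewrite /grid_adj /X /Y.
    case/orP => /andP[/eqP/= <- /orP[]] /eqP ->.
    - by rewrite subrr normr0 add0r E.
    - by rewrite subrr normr0 add0r distrC E.
    - by rewrite subrr normr0 addr0 E.
    - by rewrite subrr normr0 addr0 distrC E.
  move: (phi_lip (X u) (Y v) (X u') (Y v')) (FN _ _ Fuv) phi_gt.
  rewrite d1 !ler_norml => /andP[? ?] ? ?.
  have Kh : 0 <= K * h by rewrite mulr_ge0 // ltW.
  by apply/andP; split; lra.
move=> /constant_on_squarePn [p [pi pj Fp] [q pq Fq]].
move=> /constant_on_squarePn [p' [pi' pj' Fp'] [q' pq' Fq']].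
exists (X p.1), (Y p.2); split; first exact: FN.
  by apply: bdry Fq => //; case: (p) pq.
have XS : X p.1 + eta = X (p.1 + m)%N by rewrite /X natrD -mh; ring.
have Hq : `|phi (X (p'.1 + m)%N) (Y p'.2)| <= K * h.
  have := bdry (p'.1 + m)%N p'.2 (q'.1 + m, q'.2)%N Fp'; apply => //.
  by move: pq'; rewrite /grid_adj /= eqn_add2r -addSn -(addSn q'.1) !eqn_add2r.
have dX : `|X (p.1 + m)%N - X (p'.1 + m)%N| <= h.
  apply: (@ler_dist_natM _ _ _ _ (i + m)%N); rewrite ?(ltW h0) //.
    by rewrite -addSn !leq_add2r.
  by rewrite -addSn !leq_add2r.
have dY : `|Y p.2 - Y p'.2| <= h 
  by apply: (@ler_dist_natM _ _ _ _ j); rewrite ?(ltW h0).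
rewrite XS.
have := phi_lip (X (p.1 + m)%N) (Y p.2) (X (p'.1 + m)%N) (Y p'.2).
have : K * (`|X (p.1 + m)%N - X (p'.1 + m)%N| + `|Y p.2 - Y p'.2|) <=
    K * (h + h).
  by apply: ler_wpM2l => //; exact: lerD.
have := ler_normD (phi (X (p.1 + m)%N) (Y p.2) -
  phi (X (p'.1 + m)%N) (Y p'.2)) (phi (X (p'.1 + m)%N) (Y p'.2)).
rewrite subrK; lra.
Qed.

(** The total defect [psi] attains its minimum on the box. Approximate chords start in the box,
    because [phi <= 0] at their left end, and make [psi] arbitrarily small, so the minimum is
    zero. *)
Lemma horizontal_chord : exists x y, phi x y = 0 /\ phi (x + eta) y = 0.
Proof.
have eta0 := eta_gt0.
pose psi (p : R * R) := `|phi p.1 p.2| + `|phi (p.1 + eta) p.2|.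
pose Q : set (R * R) := (`[- B, B] `*` `[- B, B])%classic.
have Q_compact : compact Q by apply: compact_setX; exact: segment_compact.
have Qphi x y : phi x y <= 0 -> Q (x, y).
  by move=> /phi_box[]; rewrite !ler_norml => xB yB; split; rewrite /= in_itv.
have Q0 : Q !=set0.
  by exists (a, b); apply: Qphi; rewrite -[a]addr0 phi_seg // lexx ltW.
have psi_cont : continuous psi.
  apply: (@lipschitz_continuous2 _ _ (2 * K)) => p q; rewrite /psi.
  rewrite opprD addrACA; apply: le_trans (ler_normD _ _) _.
  apply: le_trans (lerD (ler_dist_dist _ _) (ler_dist_dist _ _)) _.
  rewrite -mulrA mulr_natl mulr2n; apply: lerD; first exact: phi_lip.
  apply: le_trans (phi_lip _ _ _ _) _.
  by rewrite opprD addrACA subrr addr0.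
have [|[x y] _ xy_min] := compact_EVT_min Q0 Q_compact (f := psi).
  exact: continuous_subspaceT.
exists x, y; suff : psi (x, y) <= 0.
  rewrite /psi /= => psi0.
  have := normr_ge0 (phi x y); have := normr_ge0 (phi (x + eta) y).
  by split; apply/eqP; rewrite -normr_eq0; apply/eqP; lra.
rewrite leNgt; apply/negP; set e := psi (x, y) => e0.
have K0 : 0 <= K.
  have := phi_lip 1 0 0 0; rewrite !subr0 normr1 normr0 addr0 mulr1.
  by apply: le_trans.
(* The two defects of an approximate chord add up to [4 * K * eta / m]; [m] is chosen to bring this
   below [e]. *)
have c0 : 0 <= 4 * K * eta / e by rewrite divr_ge0 ?mulr_ge0 // ltW.
have := archi_boundP c0; set m := Num.bound _ => cm.
have m0 : 0 < m%:R :> R by exact: le_lt_trans cm.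
have [|u [v [phi_le phi1 phi2]]] := @approximate_horizontal_chord m.
  by rewrite -(ltr0n R).
have := xy_min (u, v); rewrite inE => /(_ (Qphi _ _ phi_le)).
rewrite -/e /psi /=.
move: cm; rewrite ltr_pdivrMr // [_ * e]mulrC -ltr_pdivrMr //.
have -> : 4 * K * eta / m%:R = 4 * (K * (eta / m%:R)) by ring.
move: phi1 phi2; set z := eta / _; lra.
Qed.

End HorizontalChord.

End LipschitzPlane.

(** * Singular values *)

Local Notation normc := ComplexField.Normc.normc.

Section Matrices.
Local Open Scope classical_set_scope.
Local Open Scope sesquilinear_scope.
Local Open Scope complex_scope.

Section Norm2.
Variables (R : realType) (n : nat).
Implicit Types (u v : 'cV[R[i]]_n) (P : 'M[R[i]]_n).

Lemma normc_ge0 (z : R[i]) : 0 <= normc z.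
Proof. by case: z => a b; exact: sqrtr_ge0. Qed.

Lemma normc_real (x : R) : normc x%:C = `|x|.
Proof. by rewrite /= expr0n addr0 sqrtr_sqr. Qed.

Lemma ler_normc_add (x y : R) : normc (x +i* y) <= `|x| + `|y|.
Proof.
rewrite -(@ler_pXn2r _ 2) ?nnegrE ?normc_ge0 ?addr_ge0 //.
rewrite sqr_sqrtr ?addr_ge0 ?sqr_ge0 // sqrrD !real_normK ?num_real //.
by rewrite addrAC lerDl mulrn_wge0 // mulr_ge0.
Qed.

Lemma ler_Re_normc (z : R[i]) : `|complex.Re z| <= normc z.
Proof.
case: z => x y /=; rewrite -(@ler_pXn2r _ 2) ?nnegrE ?sqrtr_ge0 //.
by rewrite sqr_sqrtr ?addr_ge0 ?sqr_ge0 // real_normK ?num_real // lerDl sqr_ge0.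
Qed.

Lemma ler_Im_normc (z : R[i]) : `|complex.Im z| <= normc z.
Proof.
case: z => x y /=; rewrite -(@ler_pXn2r _ 2) ?nnegrE ?sqrtr_ge0 //.
by rewrite sqr_sqrtr ?addr_ge0 ?sqr_ge0 // real_normK ?num_real // lerDr sqr_ge0.
Qed.

Lemma norm2_ge0 v : 0 <= norm2 v.
Proof. exact: sqrtr_ge0. Qed.

Lemma sqr_norm2 v : norm2 v ^+ 2 = \sum_i normc (v i 0) ^+ 2.
Proof. by rewrite sqr_sqrtr // sumr_ge0 // => i _; exact: sqr_ge0. Qed.

Lemma sqr_norm2E v : (norm2 v ^+ 2)%:C = (v^t* *m v) 0 0.
Proof.
rewrite sqr_norm2 mxE rmorph_sum; apply: eq_bigr => i _ /=.
by rewrite !mxE mulrC -normCK rmorphXn.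
Qed.

(** Link to the Hermitian product on row vectors, whose triangle inequality is inherited in
    [norm2D]. *)
Lemma norm2_dotmx v : (norm2 v)%:C = sqrtC (dotmx v^T v^T).
Proof.
rewrite dotmxE trmxK.
have -> : (v^T *m map_mx Num.conj v) 0 0 = ((norm2 v)%:C) ^+ 2.
  rewrite -rmorphXn /= sqr_norm2E !mxE; apply: eq_bigr => i _.
  by rewrite !mxE mulrC.
by rewrite sqrCK // ler0c norm2_ge0.
Qed.

Lemma norm2D u v : norm2 (u + v) <= norm2 u + norm2 v.
Proof.
rewrite -lecR rmorphD /= !norm2_dotmx linearD.
by have [] := triangle_lerif (@dotmx R[i] n) u^T v^T.
Qed.

Lemma norm2Z (a : R[i]) v : norm2 (a *: v) = normc a * norm2 v.
Proof.
rewrite /norm2; under eq_bigr do rewrite mxE ComplexField.Normc.normcM exprMn.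
rewrite -mulr_sumr sqrtrM ?sqr_ge0 // sqrtr_sqr ger0_norm //; exact: normc_ge0.
Qed.

Lemma norm2_eq0 v : norm2 v = 0 -> v = 0.
Proof.
move=> v0; have := sqr_norm2 v; rewrite v0 expr0n /= => /esym/eqP.
rewrite psumr_eq0 => [/allP vi|i _]; last exact: sqr_ge0.
apply/matrixP => i j; rewrite ord1 mxE.
have := vi i (mem_index_enum _); rewrite sqrf_eq0 => /eqP.
exact: ComplexField.Normc.eq0_normc.
Qed.

Lemma norm2_unitary P v : P \is unitarymx -> norm2 (P *m v) = norm2 v.
Proof.
move=> Pu; apply/eqP; rewrite -(@eqrXn2 _ 2) ?norm2_ge0 //; apply/eqP.
apply: complexI; rewrite !sqr_norm2E trmx_mul map_mxM mulmxA -[_ *m P]mulmxA.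
suff -> : P^t* *m P = 1%:M by rewrite mulmx1.
by apply: mulmx1C; exact/unitarymxP.
Qed.

Lemma norm2_delta (i : 'I_n) : norm2 (delta_mx i 0 : 'cV[R[i]]_n) = 1.
Proof.
rewrite /norm2 (bigD1 i) //= big1 => [|j ji]; rewrite mxE ?eqxx ?(negbTE ji) /=.
  by rewrite expr0n expr1n /= !addr0 sqrtr1 expr1n sqrtr1.
by rewrite expr0n /= addr0 sqrtr0 expr0n.
Qed.

End Norm2.

Section SingularValues.
Variables (R : realType) (n : nat).
Implicit Types (M P : 'M[R[i]]_n) (v : 'cV[R[i]]_n).

(** Spectral theorem for the Hermitian Gram matrix. Its [i]-th eigenvalue is the squared norm of [M]
    applied to the [i]-th column of [P^t*], which supplies the real [s i]. *)
Lemma spectral_gram M : exists2 P, P \is unitarymx &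
  exists2 s : 'I_n -> R, forall i, 0 <= s i &
    M^t* *m M = P^t* *m diag_mx (\row_i (s i ^+ 2)%:C) *m P.
Proof.
set H := M^t* *m M.
have Hherm : H \is hermsymmx.
  apply/is_hermitianmxP; rewrite expr0 scale1r /H trmx_mul map_mxM; congr mulmx.
  by rewrite trmxCK.
pose P := spectralmx H; have Pu : P \is unitarymx by exact: spectral_unitarymx.
have /orthomx_spectralP := hermitian_normalmx Hherm; rewrite -/P invmx_unitary //.
move: (spectral_diag H) => d HE; exists P => //.
pose s i := norm2 (M *m (P^t* *m delta_mx i 0)).
exists s => [i|]; first exact: norm2_ge0.
rewrite [LHS]HE; congr (_ *m diag_mx _ *m _); apply/rowP => i.
rewrite !mxE sqr_norm2E !trmx_mul !map_mxM mulmxA -[_ *m M]mulmxA -/H HE.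
have PP : P *m P^t* = 1%:M by apply/unitarymxP.
rewrite trmxCK -!mulmxA (mulmxA P) PP mul1mx !mulmxA -[_ *m P *m P^t*]mulmxA PP.
rewrite mulmx1 trmx_delta map_delta_mx -rowE -colE !mxE eqxx mulr1n.
by [].
Qed.

Lemma sqr_norm2_diag (s : 'I_n -> R) M P v :
  M^t* *m M = P^t* *m diag_mx (\row_i (s i ^+ 2)%:C) *m P ->
  norm2 (M *m v) ^+ 2 = \sum_i s i ^+ 2 * normc ((P *m v) i 0) ^+ 2.
Proof.
move=> ME; apply: complexI; rewrite sqr_norm2E trmx_mul map_mxM mulmxA.
rewrite -[_ *m M]mulmxA ME !mulmxA -map_mxM -trmx_mul -[_ *m P *m v]mulmxA.
rewrite mxE rmorph_sum /=; apply: eq_bigr => i _.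
rewrite mul_mx_diag !mxE mulrC mulrA -normCK mulrC. rewrite [RHS]rmorphM.
by congr *%R; rewrite rmorphXn.
Qed.

Lemma eigenvalue_gram (s : 'I_n -> R) M P a : P \is unitarymx ->
  M^t* *m M = P^t* *m diag_mx (\row_i (s i ^+ 2)%:C) *m P ->
  eigenvalue (M^t* *m M) a <-> exists i, a = (s i ^+ 2)%:C.
Proof.
move=> Pu ->; have PP : P *m P^t* = 1%:M by exact/unitarymxP.
split => [/eigenvalueP[v vE v0]|[i ->]].
  have [w w0 wE] : exists2 w : 'rV_n, w != 0 &
      w *m diag_mx (\row_i (s i ^+ 2)%:C) = a *: w.
    exists (v *m P^t*); last first.
      by rewrite scalemxAl -vE !mulmxA -[_ *m P *m _]mulmxA PP mulmx1.
    apply: contraNneq v0 => w0; rewrite -(mulmx1 v).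
    by rewrite -(mulmx1C PP) mulmxA w0 mul0mx.
  have /rV0Pn[i wi] := w0; exists i.
  have := congr1 (fun z : 'rV_n => z 0 i) wE.
  by rewrite mul_mx_diag !mxE mulrC => /(mulIf wi) <-.
apply/eigenvalueP; exists (row i P).
  rewrite -row_mul !mulmxA PP mul1mx row_mul row_diag_mx mxE.
  by rewrite -scalemxAl -rowE.
apply/eqP => Pi0; have := congr1 (row i) PP; rewrite row_mul Pi0 mul0mx.
by move/rowP/(_ i)/eqP; rewrite !mxE eqxx eq_sym oner_eq0.
Qed.

(** The variational form of the smallest singular value, in which it is used from here on. In the
    coordinates [P *m v] the Gram form is diagonal, and the index [k] of the least [s] gives the
    minimizing vector. *)
Lemma sigma_min_spec M : (0 < n)%N ->
  (forall v, sigma_min M * norm2 v <= norm2 (M *m v)) /\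
  (exists2 v, norm2 v = 1 & norm2 (M *m v) = sigma_min M).
Proof.
move=> n0; have [P Pu [s s0 ME]] := spectral_gram M.
have PP : P *m P^t* = 1%:M by exact/unitarymxP.
pose k := [arg min_(i < Ordinal n0) s i]%O.
have k_min i : s k <= s i by rewrite /k; case: arg_minP => // j _; exact.
have sigmaE : sigma_min M = s k.
  have lbS : lbound [set t | singular_value M t] (s k).
    move=> t [t0 tM]; have [i /complexI] := (eigenvalue_gram _ Pu ME).1 tM.
    by move=> /eqP; rewrite eqrXn2 // => /eqP ->.
  have skS : singular_value M (s k).
    by split => //; apply: (eigenvalue_gram _ Pu ME).2; exists k.
  apply/eqP; rewrite eq_le; apply/andP; split.
    by apply: ge_inf => //; exists (s k).
  by apply: lb_le_inf => //; exists (s k).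
split=> [v|].
  rewrite sigmaE -(@ler_pXn2r _ 2) ?nnegrE ?mulr_ge0 ?norm2_ge0 //.
  rewrite (sqr_norm2_diag _ ME) exprMn -(norm2_unitary v Pu) sqr_norm2 mulr_sumr.
  apply: ler_sum => i _; rewrite ler_wpM2r ?sqr_ge0 //.
  by rewrite ler_pXn2r ?nnegrE.
exists (P^t* *m delta_mx k 0).
  by rewrite -(norm2_unitary _ Pu) mulmxA PP mul1mx norm2_delta.
apply/eqP; rewrite -(@eqrXn2 _ 2) ?norm2_ge0 ?sigmaE //; apply/eqP.
rewrite (sqr_norm2_diag _ ME) mulmxA PP mul1mx (bigD1 k) //= big1 => [|j jk].
  by rewrite mxE !eqxx /= expr0n expr1n /= !addr0 sqrtr1 expr1n mulr1.
by rewrite mxE (negbTE jk) /= expr0n /= addr0 sqrtr0 expr0n mulr0.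
Qed.

(** The sum of the singular values is a crude bound; it makes the supremum in [spectral_norm] a
    genuine one. *)
Lemma norm2_mulmx_bounded M : exists c, forall v, norm2 (M *m v) <= c * norm2 v.
Proof.
have [P Pu [s s0 ME]] := spectral_gram M.
exists (\sum_i s i) => v; have c0 : 0 <= \sum_i s i by exact: sumr_ge0.
rewrite -(@ler_pXn2r _ 2) ?nnegrE ?mulr_ge0 ?norm2_ge0 //.
rewrite (sqr_norm2_diag _ ME) exprMn -(norm2_unitary v Pu) sqr_norm2 mulr_sumr.
apply: ler_sum => i _; rewrite ler_wpM2r ?sqr_ge0 // ler_pXn2r ?nnegrE //.
by rewrite (bigD1 i) //= lerDl sumr_ge0.
Qed.

Section Positive.
Hypothesis n_gt0 : (0 < n)%N.

Lemma sigma_min_le M v : sigma_min M * norm2 v <= norm2 (M *m v).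
Proof. by have [] := sigma_min_spec M n_gt0. Qed.

Lemma sigma_min_attained M :
  exists2 v, norm2 v = 1 & norm2 (M *m v) = sigma_min M.
Proof. by have [] := sigma_min_spec M n_gt0. Qed.

Lemma sigma_min_ge0 M : 0 <= sigma_min M.
Proof. by have [v _ <-] := sigma_min_attained M; exact: norm2_ge0. Qed.

(** Test the perturbed matrix on a minimizing vector of [M]; this is the source of the Lipschitz
    bound. *)
Lemma sigma_minD_scalar M (z : R[i]) :
  sigma_min (M + z%:M) <= sigma_min M + normc z.
Proof.
have [v v1 <-] := sigma_min_attained M.
have := sigma_min_le (M + z%:M) v; rewrite v1 mulr1 => /le_trans; apply.
rewrite mulmxDl mul_scalar_mx; apply: le_trans (norm2D _ _) _.
by rewrite norm2Z v1 mulr1.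
Qed.

Lemma sigma_minZ M (a : R[i]) : sigma_min (a *: M) = normc a * sigma_min M.
Proof.
apply/eqP; rewrite eq_le; apply/andP; split.
  have [v v1 <-] := sigma_min_attained M.
  by have := sigma_min_le (a *: M) v; rewrite v1 mulr1 -scalemxAl norm2Z.
have [v v1 <-] := sigma_min_attained (a *: M).
rewrite -scalemxAl norm2Z ler_wpM2l ?normc_ge0 //.
by have := sigma_min_le M v; rewrite v1 mulr1.
Qed.

Lemma sigma_min_gt0 M : M \in unitmx -> 0 < sigma_min M.
Proof.
move=> Mu; rewrite lt_def sigma_min_ge0 andbT.
have [v v1 <-] := sigma_min_attained M.
apply/negP => /eqP/norm2_eq0 Mv.
have := mulKmx Mu v; rewrite Mv mulmx0 => v0; move: v1.
rewrite -v0 -(scale0r (0 : 'cV[R[i]]_n)) norm2Z.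
by rewrite ComplexField.Normc.normc0 mul0r => /eqP; rewrite eq_sym oner_eq0.
Qed.

Lemma sigma_min_singular M : M \notin unitmx -> sigma_min M = 0.
Proof.
move=> Mu; have : \det M^T == 0.
  by move: Mu; rewrite det_tr unitmxE unitfE negbK.
move=> /det0P[w w0 wM].
have Mw : M *m w^T = 0 by rewrite -[M]trmxK -trmx_mul wM trmx0.
have := sigma_min_le M w^T; rewrite Mw.
have -> : norm2 (0 : 'cV[R[i]]_n) = 0.
  by rewrite -(scale0r (0 : 'cV[R[i]]_n)) norm2Z ComplexField.Normc.normc0 mul0r.
have w_gt0 : 0 < norm2 w^T.
  rewrite lt_def norm2_ge0 andbT; apply: contraNneq w0 => /norm2_eq0 w0.
  by rewrite -[w]trmxK w0 trmx0.
by rewrite pmulr_lle0 // => ?; apply/eqP; rewrite eq_le sigma_min_ge0 // andbT.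
Qed.

Lemma spectral_norm_invmx M : M \in unitmx ->
  spectral_norm (invmx M) <= (sigma_min M)^-1.
Proof.
move=> Mu; apply: ge_sup.
  exists (norm2 (invmx M *m delta_mx (Ordinal n_gt0) 0)).
  by exists (delta_mx (Ordinal n_gt0) 0) => //=; exact: norm2_delta.
move=> _ [v v1 <-]; rewrite -[leRHS]mul1r ler_pdivlMr ?sigma_min_gt0 // mulrC.
have := sigma_min_le M (invmx M *m v).
by rewrite mulmxA mulmxV // mul1mx v1.
Qed.

Lemma spectral_norm_ge0 M : 0 <= spectral_norm M.
Proof.
have [c Mc] := norm2_mulmx_bounded M.
apply: le_trans (norm2_ge0 (M *m delta_mx (Ordinal n_gt0) 0)) _.
apply: ub_le_sup; last first.
  by exists (delta_mx (Ordinal n_gt0) 0) => //=; exact: norm2_delta.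
by exists c => _ [v v1 <-]; have := Mc v; rewrite v1 mulr1.
Qed.

End Positive.
End SingularValues.

(** * The function g and the Kreiss constant *)

Section Resolvent.
Variables (R : realType) (n : nat) (A : 'M[R[i]]_n).
Hypothesis n_gt0 : (0 < n)%N.

Lemma eigenvalue_unitmx (z : R[i]) : eigenvalue A z = (z%:M - A \notin unitmx).
Proof.
rewrite /eigenvalue /eigenspace kermx_eq0 row_free_unit -opprB -scaleN1r.
by rewrite unitmxZ // unitrN1.
Qed.

(** The function [f] of the overview. Unlike [kreiss_g] it involves no division by [x], so it makes
    sense on the whole plane. *)
Definition resolvent_gap (x y : R) := sigma_min ((x +i* y)%:M - A).

Lemma resolvent_gap_lipschitz x y x' y' :
  `|resolvent_gap x y - resolvent_gap x' y'| <= `|x - x'| + `|y - y'|.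
Proof.
have H a b a' b' :
    resolvent_gap a b <= resolvent_gap a' b' + (`|a - a'| + `|b - b'|).
  rewrite /resolvent_gap.
  have -> : (a +i* b)%:M - A =
      ((a' +i* b')%:M - A) + ((a - a') +i* (b - b'))%:M.
    rewrite addrAC -[in RHS]raddfD /=; congr (_%:M - _).
    by apply/eqP; rewrite eq_complex /= !subrKC !eqxx.
  apply: le_trans (sigma_minD_scalar n_gt0 _ _) _.
  by rewrite lerD2l ler_normc_add.
move: resolvent_gap H => g H.
rewrite ler_distl; apply/andP; split; last exact: H.
rewrite lerBlDr; have := H x' y' x y.
by rewrite (distrC x') (distrC y').
Qed.

Lemma kreiss_gE x y : 0 < x -> kreiss_g A x y = resolvent_gap x y / x.
Proof.
move=> x0; rewrite /kreiss_g sigma_minZ // ComplexField.Normc.normcV normc_real.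
by rewrite gtr0_norm // mulrC.
Qed.

(** For a unit vector [v], [z v] is the sum of [(z - A) v] and [A v]. The bound confines both the
    spectrum and the set [phi <= 0]. *)
Lemma resolvent_gap_ge :
  exists c, forall x y, normc (x +i* y) - c <= resolvent_gap x y.
Proof.
have [c Ac] := norm2_mulmx_bounded A; exists c => x y.
rewrite /resolvent_gap; set z := _ +i* _.
have [v v1 <-] := sigma_min_attained n_gt0 (z%:M - A).
have := Ac v; rewrite v1 mulr1 => Av.
have zv : normc z = norm2 ((z%:M - A) *m v + A *m v).
  by rewrite mulmxBl subrK mul_scalar_mx norm2Z v1 mulr1.
have := norm2D ((z%:M - A) *m v) (A *m v); rewrite -zv; lra.
Qed.

(** The supremum defining the abscissa bounds eigenvalues only if their real parts are bounded
    above. This comes from [resolvent_gap_ge], as the gap vanishes at eigenvalues. *)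
Lemma resolvent_unit (z : R[i]) : spectral_abscissa A < 0 ->
  0 <= complex.Re z -> z%:M - A \in unitmx.
Proof.
move=> alpha z0; apply: contraTT alpha; rewrite -eigenvalue_unitmx -leNgt => zA.
apply: le_trans z0 _; apply: ub_le_sup; last by exists z.
have [c Ac] := resolvent_gap_ge; exists c => _ [[a b] /= aA <-].
have := Ac a b; rewrite /resolvent_gap (sigma_min_singular n_gt0); last first.
  by rewrite -eigenvalue_unitmx.
rewrite subr_le0; apply: le_trans; apply: le_trans (ler_norm _) _.
exact: (ler_Re_normc (a +i* b)).
Qed.

Lemma resolvent_gap_gt0 x y : spectral_abscissa A < 0 -> 0 <= x ->
  0 < resolvent_gap x y.
Proof. by move=> ? ?; apply: sigma_min_gt0 => //; exact: resolvent_unit. Qed.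

Lemma kreiss_g_gt0 x y : spectral_abscissa A < 0 -> 0 < x -> 0 < kreiss_g A x y.
Proof.
by move=> ? x0; rewrite kreiss_gE // divr_gt0 // resolvent_gap_gt0 // ltW.
Qed.

(** Each term of the Kreiss supremum is at most [1 / g], hence at most [1 / k]. Both hypotheses on
    the Kreiss constant pass to [k] through this inequality. *)
Lemma kreiss_global_minimum_le xs ys : spectral_abscissa A < 0 ->
  kreiss_global_minimizer A xs ys ->
  ((kreiss_g A xs ys)%:E <= (kreiss_constant A)^-1)%E.
Proof.
move=> alpha [xs0 gmin]; set k := kreiss_g A xs ys.
have k0 : 0 < k by exact: kreiss_g_gt0.
have -> : (k%:E = (k^-1%:E)^-1)%E by rewrite inver invr_eq0 gt_eqF // invrK.
rewrite lee_pV2 ?inE; last 2 first.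
- by rewrite lee_fin invr_ge0 ltW.
- apply: (@le_trans _ _ (xs%:E * resolvent_norm A (xs +i* ys))%E); last first.
    by apply: ereal_sup_ubound; exists (xs +i* ys).
  rewrite /resolvent_norm resolvent_unit ?(ltW xs0) // -EFinM lee_fin.
  by rewrite mulr_ge0 ?(ltW xs0) // spectral_norm_ge0.
apply: ge_ereal_sup => _ [[x y] /= x0 <-].
have zu : (x +i* y)%:M - A \in unitmx by rewrite resolvent_unit ?ltW.
rewrite /resolvent_norm zu -EFinM lee_fin.
have := gmin x y x0; rewrite -/k kreiss_gE // => kg.
have f0 : 0 < resolvent_gap x y by rewrite resolvent_gap_gt0 // ltW.
apply: (@le_trans _ _ (x / resolvent_gap x y)).
  by rewrite ler_wpM2l ?(ltW x0) // spectral_norm_invmx.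
move: (resolvent_gap _ _) f0 kg => g f0 kg.
by rewrite -invf_div lef_pV2 // posrE divr_gt0.
Qed.
End Resolvent.

End Matrices.

(** * Reduction of the level set of [g] to a chord of the zero set of [phi] *)

Theorem theorem4p6 (R : realType) (n : nat) (A : 'M[R[i]]_n)
    (gamma eta xs ys : R) :
  (0 < n)%N ->
  spectral_abscissa A < 0 ->
  0 <= gamma -> gamma < 1 ->
  0 <= eta ->
  kreiss_global_minimizer A xs ys ->
  ((kreiss_constant A)^-1 <= gamma%:E)%E ->
  (eta%:E <= (2 * xs / (1 + gamma))%:E
             * (gamma%:E - (kreiss_constant A)^-1))%E ->
  exists x y : R,
    [/\ 0 < x, kreiss_g A x y = gamma & kreiss_g A (x + eta) y = gamma].
Proof.
move=> n0 alpha g0 g1 eta0 gmin Kg Keta; have [xs0 _] := gmin.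
have := kreiss_global_minimum_le n0 alpha gmin.
have : 0 < kreiss_g A xs ys by exact: kreiss_g_gt0.
have f_gt0 x y : 0 <= x -> 0 < resolvent_gap A x y.
  exact: resolvent_gap_gt0.
have f_ge0 x y : 0 <= resolvent_gap A x y by exact: sigma_min_ge0.
have f_lip := resolvent_gap_lipschitz A n0.
have [c f_ge] := resolvent_gap_ge A n0.
have gE x y : 0 < x -> kreiss_g A x y = resolvent_gap A x y / x.
  exact: kreiss_gE.
move: (kreiss_g A) (resolvent_gap A) gE f_gt0 f_ge0 f_lip f_ge.
move=> g f gE f_gt0 f_ge0 f_lip f_ge k0 kK.
have : f xs ys = g xs ys * xs by rewrite gE // divfK // gt_eqF.
move: (g xs ys) k0 kK => k k0 kK fk.
have g1' : 0 < 1 + gamma by lra.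
(* The inverse Kreiss constant lies between [k] and [gamma], so it is a real [r >= k]; replacing [r]
   by [k] relaxes the bound on [eta]. *)
have {kK Kg Keta}[kg eta_le] : k <= gamma /\
    eta * (1 + gamma) <= 2 * xs * (gamma - k).
  move: kK Kg Keta; case: ((kreiss_constant A)^-1)%E => [r| |] //=.
  rewrite !lee_fin => kr rg Keta; split; first exact: le_trans kr rg.
  have : eta <= 2 * xs / (1 + gamma) * (gamma - r) by [].
  rewrite mulrAC ler_pdivlMr // => /le_trans; apply.
  by apply: ler_wpM2l; lra.
pose phi x y := f x y - gamma * x.
(* On the imaginary axis stability gives [f > 0]. To its left [f] may vanish, but [gamma * x < 0]
   because [gamma >= k > 0]. *)
have phi_pos x y : phi x y <= 0 -> 0 < x.
  rewrite /phi subr_le0 => fx; rewrite ltNge; apply/negP => x0.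
  have [xE|x0'] := eqVneq x 0.
    have := f_gt0 x y; move: fx.
    by rewrite xE mulr0 lexx leNgt => /negP fx /(_ isT).
  have : gamma * x < 0 by rewrite pmulr_rlt0 ?lt_neqAle ?x0' //; lra.
  by rewrite ltNge (le_trans (f_ge0 x y) fx).
have phi_lip x y x' y' :
    `|phi x y - phi x' y'| <= 2 * (`|x - x'| + `|y - y'|).
  have -> : phi x y - phi x' y' = (f x y - f x' y') - gamma * (x - x').
    by rewrite /phi; ring.
  apply: le_trans (ler_normB _ _) _; rewrite mulr_natl mulr2n.
  apply: lerD; first exact: f_lip.
  rewrite normrM ger0_norm //; apply: le_trans (_ : `|x - x'| <= _).
    by rewrite ler_piMl // ltW.
  by rewrite lerDl.
(* With [z] the modulus, [z - c <= f <= gamma * x <= gamma * z]. *)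
have phi_box x y : phi x y <= 0 ->
    `|x| <= c / (1 - gamma) /\ `|y| <= c / (1 - gamma).
  move=> phixy; have := ler_Re_normc (Complex x y).
  have := ler_Im_normc (Complex x y); rewrite [complex.Im _]/= [complex.Re _]/=.
  have : x <= `|x| by exact: ler_norm.
  have := f_ge x y; move: phixy; rewrite /phi.
  move: (ComplexField.Normc.normc _) (f x y) => z w hw cw.
  move: `|x| `|y| => p q xp qz pz.
  have zB : z <= c / (1 - gamma).
    by rewrite ler_pdivlMr ?subr_gt0 //; nra.
  by split; apply: le_trans zB.
(* The bound [f <= k * xs + |w - xs|] gives [phi <= 0] for [w] from [xs * (1 + k) / (1 + gamma)] to
   [xs * (1 - k) / (1 - gamma)]. This interval has length [2 * xs * (gamma - k) / (1 - gamma ^ 2)],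
   which is at least [eta]. *)
have phi_seg t : 0 <= t <= eta -> phi (xs * (1 + k) / (1 + gamma) + t) ys <= 0.
  move=> /andP[t0 teta]; set w := _ + t.
  have aE : (1 + gamma) * w = xs * (1 + k) + (1 + gamma) * t.
    by rewrite /w mulrDr mulrC divfK ?gt_eqF.
  have := f_lip w ys xs ys; rewrite subrr normr0 addr0 fk.
  rewrite ler_distl => /andP[_ fw]; rewrite /phi.
  have [xw|wx] := leP xs w.
    move: fw; rewrite ger0_norm ?subr_ge0 // => fw.
    have : (1 - gamma) * w <= (1 - k) * xs.
      rewrite -(ler_pM2l g1') mulrCA.
      have h : (1 + gamma) * w <= xs * (1 + 2 * gamma - k) by nra.
      apply: le_trans (_ : (1 - gamma) * (xs * (1 + 2 * gamma - k)) <= _).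
        by rewrite ler_wpM2l //; lra.
      rewrite -subr_ge0; have -> : (1 + gamma) * ((1 - k) * xs) -
        (1 - gamma) * (xs * (1 + 2 * gamma - k)) = 2 * gamma * xs * (gamma - k).
        by ring.
      by rewrite !mulr_ge0 // ?(ltW xs0) //; lra.
    by lra.
  move: fw; rewrite ler0_norm ?subr_le0 ?(ltW wx) // => fw.
  by have := mulr_ge0 (ltW g1') t0; lra.
have [x [y [xy0 xy1]]] : exists x y, phi x y = 0 /\ phi (x + eta) y = 0.
  (* For [eta = 0] the mesh [eta / m] degenerates, so a single zero of [phi] is found instead. *)
  move: eta0; rewrite le_eqVlt => /predU1P[eta0|eta0].
    have [|x phix] := lipschitz_zero_on_line phi_lip phi_box (phi_seg 0 _).
      by rewrite lexx -eta0 lexx.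
    by exists x, ys; rewrite -eta0 addr0.
  exact: horizontal_chord phi_lip phi_box eta0 phi_seg.
have x0 : 0 < x by apply: (phi_pos x y); rewrite xy0.
have gz z : 0 < z -> phi z y = 0 -> g z y = gamma.
  move=> z0 /eqP; rewrite subr_eq0 => /eqP fz.
  by rewrite gE // fz mulfK // gt_eqF.
by exists x, y; split=> //; apply: gz => //; rewrite ltr_wpDr.
Qed.
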